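(* Let $K \subset X \subset B_n$ be compact basic semialgebraic sets with the given polynomial descriptions $(g_i^K)_i$, $(g_i^X)_i$, satisfying the standing assumptions listed in the context (in particular $0 \in \mathrm{int}\,K$ and the finite Gibbs phenomenon assumption). Then, as $d\to\infty$, $$v_d^\star - \mathrm{vol}\,K = O\left(\frac{1}{\log\log d}\right).$$
   Context: Setting. $B_n := \{x\in\mathbb{R}^n : \|x\|_2 \le 1\}$. The sets $$K := \{x\in\mathbb{R}^n : g_i^K(x)\ge 0,\ i=1,\dots,n_K\},\qquad X := \{x\in\mathbb{R}^n : g_i^X(x)\ge 0,\ i=1,\dots,n_X\}$$ are compact basic semialgebraic sets described by real polynomials $g_i^K, g_i^X\in\mathbb{R}[x]$, with $K\subset X\subset B_n$. Put $g_0^K := g_0^X := 1$. It is assumed that one of the $g_i^K$ with $i>0$, and one of the $g_i^X$ with $i>0$, equals $1-\sum_{k=1}^n x_k^2$. It is assumed that $0\in\mathrm{int}\,K$. $\mathrm{vol}$ denotes Lebesgue measure on $\mathbb{R}^n$, $\int_X p := \int_X p(x)\,dx$, and $I_K$ is the indicator function of $K$ (equal to $1$ on $K$ and $0$ outside). Truncated quadratic modules. Let $\Sigma[x]\subset\mathbb{R}[x]$ be the cone of sums of squares of polynomials and $\mathbb{R}[x]_d$ the space of polynomials of total degree at most $d$. For $S\in\{K,X\}$, $$Q_d(S) := \Bigl\{\sum_{i=0}^{n_S} g_i^S s_i^S : s_i^S\in\Sigma[x],\ \deg(g_i^S s_i^S)\le 2\lfloor d/2\rfloor\Bigr\}.$$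 Hierarchy. For $d\in\mathbb{N}$, $$v_d^\star := \inf\Bigl\{\int_X p \ :\ p\in\mathbb{R}[x]_d,\ p-1\in Q_d(K),\ p\in Q_d(X)\Bigr\}.$$ Finite Gibbs phenomenon assumption. There is a sequence $(p_d)_{d\in\mathbb{N}}$ such that, for each $d$, $p_d$ is a minimizer of $\int_X (p-I_K)$ over all $p\in\mathbb{R}[x]_d$ with $p\ge I_K$ on $X$, and a finite constant $c_G$ (independent of $d$) such that $\max_{x\in X}p_d(x)\le c_G$ for all $d$. *)

(* Defs.v *)
(* MathComp-Analysis, with multivariate polynomials from multinomials.
   The notations of mpoly clash with those of MathComp-Analysis, hence the
   restricted import and the qualified names. *)
From HB Require Import structures.
From mathcomp Require Import all_boot all_order all_algebra.
From mathcomp Require Import all_classical all_reals all_analysis.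
From mathcomp Require Import measurable_realfun.
From mathcomp Require Import(canonicals,coercions) mpoly.

Set Implicit Arguments.
Unset Strict Implicit.
Unset Printing Implicit Defensive.

Import Order.TTheory GRing.Theory Num.Theory.
Import numFieldNormedType.Exports.

Local Open Scope classical_set_scope.
Local Open Scope ring_scope.

(* The sigma-algebra on R^n generated by the coordinates (i.e. the Borel one),
   as in the library's instance for n.-tuple T. *)
Section measurable_rV.
Variables (R : realType) (n : nat).

Definition rV_coord (i : 'I_n) (x : 'rV[R]_n) : measurableTypeR R := x ord0 i.

Let rV_set0 : g_sigma_preimage rV_coord set0.
Proof. exact: sigma_algebra0. Qed.

Let rV_setC A : g_sigma_preimage rV_coord A -> g_sigma_preimage rV_coord (~` A).
Proof. exact: sigma_algebraC. Qed.

Let rV_bigcup (F : (set 'rV[R]_n)^nat) :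
  (forall i, g_sigma_preimage rV_coord (F i)) ->
  g_sigma_preimage rV_coord (\bigcup_i (F i)).
Proof. exact: sigma_algebra_bigcup. Qed.

HB.instance Definition _ := @isMeasurable.Build default_measure_display
  'rV[R]_n (g_sigma_preimage rV_coord) rV_set0 rV_setC rV_bigcup.

Lemma measurable_rV_coord (i : 'I_n) : measurable_fun [set: 'rV[R]_n] (rV_coord i).
Proof.
move=> _ Y mY; rewrite setTI; apply: sub_sigma_algebra => /=.
rewrite -bigcup_seq/=; exists i => /=; first by rewrite mem_index_enum.
by exists Y => //; rewrite setTI.
Qed.

Lemma measurable_fun_rVP d (T : measurableType d) (f : T -> 'rV[R]_n) :
  (forall i, measurable_fun [set: T] (rV_coord i \o f)) ->
  measurable_fun [set: T] f.
Proof.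
move=> mf _ A mA; rewrite setTI.
suff : g_sigma_preimage rV_coord `<=` [set B | measurable (f @^-1` B)] by apply.
apply: smallest_sub.
  split => /=.
  - by rewrite preimage_set0.
  - by move=> B mB; rewrite setTD preimage_setC; exact: measurableC.
  - by move=> F mF; rewrite preimage_bigcup; exact: bigcup_measurable.
rewrite -bigcup_seq/= => B [i _ [C mC <-]] /=.
have := mf i measurableT C mC; rewrite !setTI.
by rewrite comp_preimage.
Qed.

End measurable_rV.

Section lebesgue_rV.
Variable R : realType.

Definition rV_cons n (ax : measurableTypeR R * 'rV[R]_n) : 'rV[R]_n.+1 :=
  row_mx (ax.1%:M : 'rV[R]_1) ax.2.

Definition rV_uncons n (x : 'rV[R]_n.+1) : measurableTypeR R * 'rV[R]_n :=
  (x ord0 ord0, @rsubmx R 1 1 n x).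

Lemma rV_consK n : cancel (@rV_cons n) (@rV_uncons n).
Proof.
move=> [a x]; rewrite /rV_uncons /rV_cons /= row_mxKr; congr pair.
transitivity (row_mx (a%:M : 'rV[R]_1) x ord0 (lshift n ord0)).
  by congr (row_mx _ _ _ _); exact: val_inj.
by rewrite row_mxEl mxE eqxx mulr1n.
Qed.

Lemma rV_cons0 n (ax : measurableTypeR R * 'rV[R]_n) :
  rV_cons ax ord0 ord0 = ax.1.
Proof. by have /(congr1 fst) := rV_consK ax. Qed.

Lemma rV_consS n (ax : measurableTypeR R * 'rV[R]_n) (i : 'I_n) :
  rV_cons ax ord0 (lift ord0 i) = ax.2 ord0 i.
Proof.
rewrite -(row_mxEr (ax.1%:M : 'rV[R]_1) ax.2).
by congr (row_mx _ _ _ _); exact: val_inj.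
Qed.

Lemma measurable_rV_cons n : measurable_fun setT (@rV_cons n).
Proof.
apply: measurable_fun_rVP => i.
have [j ->|->] := unliftP ord0 i.
- have -> : rV_coord (lift ord0 j) \o @rV_cons n = rV_coord j \o snd.
    by apply/funext => ax /=; rewrite /rV_coord rV_consS.
  by apply: measurableT_comp => //; exact: measurable_rV_coord.
- have -> : rV_coord ord0 \o @rV_cons n = fst.
    by apply/funext => ax /=; rewrite /rV_coord rV_cons0.
  exact: measurable_fst.
Qed.

Lemma measurable_rV_uncons n : measurable_fun setT (@rV_uncons n).
Proof.
apply/measurable_fun_pairP; split; first exact: (measurable_rV_coord ord0).
apply: measurable_fun_rVP => i.
have -> : rV_coord i \o (snd \o @rV_uncons n) = rV_coord (lift ord0 i).
  by apply/funext => x; rewrite /= /rV_coord mxE; congr (x _ _); exact: val_inj.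
exact: measurable_rV_coord.
Qed.

Section step.
Variables (n : nat) (m : {sigma_finite_measure set 'rV[R]_n -> \bar R}).

Definition lebesgue_rV_step : set 'rV[R]_n.+1 -> \bar R :=
  pushforward (@lebesgue_measure R \x m)%E (@rV_cons n).

Let preimage_cons A : measurable A -> measurable (@rV_cons n @^-1` A).
Proof. by move=> mA; rewrite -[_ @^-1` _]setTI; exact: measurable_rV_cons. Qed.

Let step0 : lebesgue_rV_step set0 = 0%E.
Proof. by rewrite /lebesgue_rV_step /pushforward preimage_set0 measure0. Qed.

Let step_ge0 A : (0 <= lebesgue_rV_step A)%E.
Proof. exact: (measure_ge0 (@lebesgue_measure R \x m)%E). Qed.

Let step_sigma_additive : semi_sigma_additive lebesgue_rV_step.
Proof.
move=> F mF tF mUF; rewrite /lebesgue_rV_step /pushforward preimage_bigcup.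
apply: measure_semi_sigma_additive.
- by move=> k; exact: preimage_cons.
- apply/trivIsetP => /= i j _ _ ij; rewrite -preimage_setI.
  by move/trivIsetP : tF => /(_ _ _ _ _ ij) ->//; rewrite preimage_set0.
- by rewrite -preimage_bigcup; exact: preimage_cons.
Qed.

HB.instance Definition _ := isMeasure.Build _ _ _ lebesgue_rV_step
  step0 step_ge0 step_sigma_additive.

Let step_sigma_finite : sigma_finite setT lebesgue_rV_step.
Proof.
have /sigma_finiteP[F [TF ndF Foo]] := sigma_finiteT (@lebesgue_measure R).
have /sigma_finiteP[G [TG ndG Goo]] := sigma_finiteT m.
exists (fun k => @rV_uncons n @^-1` (F k `*` G k)).
  rewrite -preimage_bigcup (_ : \bigcup_k _ = setT) ?preimage_setT//.
  apply/seteqP; split=> // -[a x] _.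
  have [i _ Fia] : (\bigcup_i F i) a by rewrite -TF.
  have [j _ Gjx] : (\bigcup_j G j) x by rewrite -TG.
  exists (maxn i j) => //; split => /=.
  - by move: a Fia; exact/subsetPset/ndF/leq_maxl.
  - by move: x Gjx; exact/subsetPset/ndG/leq_maxr.
move=> k; have [mF Foo'] := Foo k; have [mG Goo'] := Goo k; split.
  rewrite -[_ @^-1` _]setTI; apply: measurable_rV_uncons => //.
  exact: measurableX.
rewrite /lebesgue_rV_step /pushforward -comp_preimage.
have -> : @rV_uncons n \o @rV_cons n = id by apply/funext; exact: rV_consK.
by rewrite preimage_id product_measure1E// lte_mul_pinfty// ge0_fin_numE.
Qed.

HB.instance Definition _ := Measure_isSigmaFinite.Build _ _ _ lebesgue_rV_step
  step_sigma_finite.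

End step.

(* Lebesgue measure on R^n: image of the n-fold product of Lebesgue measures on
   R; lebesgue_rV_box below gives its value on products of measurable sets. *)
Fixpoint lebesgue_rV n : {sigma_finite_measure set 'rV[R]_n -> \bar R} :=
  if n is k.+1 then lebesgue_rV_step (lebesgue_rV k) else \d_(0 : 'rV[R]_0).

Lemma measurable_rV_box n (A : 'I_n -> set (measurableTypeR R)) :
  (forall i, measurable (A i)) ->
  measurable [set x : 'rV[R]_n | forall i, A i (x ord0 i)].
Proof.
move=> mA; have -> : [set x : 'rV[R]_n | forall i, A i (x ord0 i)] =
    \bigcap_(i in [set: 'I_n]) (@rV_coord R n i @^-1` A i).
  by apply/seteqP; split=> x /= Ax i => [_|]; apply: Ax.
apply: fin_bigcap_measurable => // i _; rewrite -[_ @^-1` _]setTI.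
exact: measurable_rV_coord.
Qed.

Lemma lebesgue_rV_box n (A : 'I_n -> set (measurableTypeR R)) :
  (forall i, measurable (A i)) ->
  lebesgue_rV n [set x | forall i, A i (x ord0 i)] =
  (\prod_(i < n) lebesgue_measure (A i))%E.
Proof.
elim: n A => [|n IHn] A mA.
  by rewrite big_ord0 /= diracE mem_set//= => -[].
have mA' i : measurable (A (lift ord0 i)) by exact: mA.
have mB := measurable_rV_box mA'.
rewrite big_ord_recl -(IHn _ mA') -product_measure1E//.
rewrite /= /lebesgue_rV_step /pushforward; congr product_measure1.
apply/seteqP; split=> [ax /= Aax|ax [/= A0 AS] i].
  split => [|i] /=; first by rewrite -rV_cons0.
  by rewrite -rV_consS.
by have [j ->|->] := unliftP ord0 i; rewrite ?rV_consS ?rV_cons0//; exact: AS.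
Qed.

End lebesgue_rV.

Section polynomials.
Variables (R : realType) (n : nat).

Definition peval (p : mpoly.mpoly n R) (x : 'rV[R]_n) : R :=
  mpoly.meval (fun i => x ord0 i) p.

(* mpoly.msize p is 1 + the total degree of p, and 0 if p = 0. *)
Definition deg_le (d : nat) (p : mpoly.mpoly n R) : Prop :=
  (mpoly.msize p <= d.+1)%N.

(* 1 - x_1^2 - ... - x_n^2 *)
Definition ball_poly : mpoly.mpoly n R :=
  1 - \sum_(k < n) (mpoly.mpolyX R (mpoly.mnm1 k)) ^+ 2.

(* Euclidean ball; the library norm on 'rV[R]_n is the sup norm. *)
Definition unit_ball : set 'rV[R]_n :=
  [set x | Num.sqrt (\sum_(k < n) x ord0 k ^+ 2) <= 1].

Definition sos (s : mpoly.mpoly n R) : Prop :=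
  exists qs : seq (mpoly.mpoly n R), s = \sum_(q <- qs) q ^+ 2.

Definition semialg m (g : 'I_m -> mpoly.mpoly n R) : set 'rV[R]_n :=
  [set x | forall i, 0 <= peval (g i) x].

(* The family g is extended by g_0 = 1: the index ord0 stands for 0 and
   lift ord0 j for the j-th given polynomial. *)
Definition with_one m (g : 'I_m -> mpoly.mpoly n R) (i : 'I_m.+1) : mpoly.mpoly n R :=
  if unlift ord0 i is Some j then g j else 1.

(* Truncated quadratic module Q_d of the set described by g; it depends on the
   description g and not only on the set semialg g. *)
Definition quad_module m (g : 'I_m -> mpoly.mpoly n R) (d : nat) :
    set (mpoly.mpoly n R) :=
  [set p | exists s : 'I_m.+1 -> mpoly.mpoly n R,
     [/\ forall i, sos (s i),
         forall i, deg_le (2 * d./2)%N (with_one g i * s i) &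
         p = \sum_(i < m.+1) with_one g i * s i]].

(* v_d^star; see vstar_fin_num below for its finiteness. *)
Definition vstar mK (gK : 'I_mK -> mpoly.mpoly n R)
    mX (gX : 'I_mX -> mpoly.mpoly n R) (d : nat) : \bar R :=
  ereal_inf [set (\int[lebesgue_rV R n]_(x in semialg gX) (peval p x)%:E)%E |
    p in [set p | [/\ deg_le d p, quad_module gK d (p - 1) & quad_module gX d p]]].

Definition majorant (K X : set 'rV[R]_n) (d : nat) (p : mpoly.mpoly n R) : Prop :=
  deg_le d p /\ forall x, X x -> \1_K x <= peval p x.

Definition best_majorant (K X : set 'rV[R]_n) (d : nat) (p : mpoly.mpoly n R) : Prop :=
  majorant K X d p /\
  forall q, majorant K X d q ->
    (\int[lebesgue_rV R n]_(x in X) (peval p x - \1_K x)%:E <=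
     \int[lebesgue_rV R n]_(x in X) (peval q x - \1_K x)%:E)%E.

(* Finite Gibbs phenomenon: optimal majorants of 1_K, one per degree d, bounded
   on X uniformly in d. *)
Definition finite_gibbs (K X : set 'rV[R]_n) : Prop :=
  exists p : nat -> mpoly.mpoly n R,
    (forall d, best_majorant K X d (p d)) /\
    exists cG : R, forall d x, X x -> peval (p d) x <= cG.

Lemma peval1 x : peval 1 x = 1.
Proof. exact: mpoly.meval1. Qed.

Lemma measurable_peval p : measurable_fun setT (peval p).
Proof.
rewrite (_ : peval p = fun x => \sum_(m <- mpoly.msupp p)
    mpoly.mcoeff m p * \prod_(i < n) rV_coord i x ^+ tnth m i).
  apply: measurable_sum => m; apply: measurable_funM => //.
  apply: measurable_prod => i _; apply: measurable_funX.
  exact: measurable_rV_coord.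
by apply/funext => x; rewrite /peval mpoly.mevalE.
Qed.

Lemma measurable_semialg m (g : 'I_m -> mpoly.mpoly n R) :
  measurable (semialg g).
Proof.
rewrite (_ : semialg g = \bigcap_(i in [set: 'I_m]) (peval (g i) @^-1` `[0, +oo[)).
  apply: fin_bigcap_measurable => // i _; rewrite -[_ @^-1` _]setTI.
  exact: measurable_peval.
apply/seteqP; split=> x /= gx i; last by have := gx i I; rewrite /= in_itv/= andbT.
by rewrite /= in_itv/= andbT.
Qed.

Lemma lebesgue_rV_semialg_fin_num m (g : 'I_m -> mpoly.mpoly n R) :
  semialg g `<=` unit_ball -> lebesgue_rV R n (semialg g) \is a fin_num.
Proof.
move=> gB; pose A (i : 'I_n) : set (measurableTypeR R) := `[-1, 1]%classic.
have mA i : measurable (A i) by exact: measurable_itv.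
rewrite ge0_fin_numE; last exact: measure_ge0.
apply: (@le_lt_trans _ _ (lebesgue_rV R n [set x | forall i, A i (x ord0 i)])).
  apply: le_measure; rewrite ?inE.
  - exact: measurable_semialg.
  - exact: measurable_rV_box.
  move=> x /gB /= x1 i; rewrite /A /= in_itv/= -ler_norml -sqrtr_sqr.
  apply: le_trans x1; apply: ler_wsqrtr; rewrite (bigD1 i)//= lerDl.
  by apply: sumr_ge0 => j _; exact: sqr_ge0.
rewrite lebesgue_rV_box// ltey_eq; apply/orP; left.
apply: (big_ind (fun x => x \is a fin_num)) => // [x y|i _]; first exact: fin_numM.
by rewrite lebesgue_measure_itv/= lte_fin; case: ifP.
Qed.

Lemma vstar_fin_num mK (gK : 'I_mK -> mpoly.mpoly n R)
    mX (gX : 'I_mX -> mpoly.mpoly n R) d :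
  semialg gX `<=` unit_ball -> vstar gK gX d \is a fin_num.
Proof.
move=> gB; rewrite fin_numElt; apply/andP; split.
  apply: (@lt_le_trans _ _ 0%E) => //; apply: le_ereal_inf_tmp.
  move=> _ [p [_ _ [s [soss _ ->]]] <-]; apply: integral_ge0 => x gx.
  rewrite lee_fin /peval raddf_sum; apply: sumr_ge0 => i _; rewrite /= mpoly.mevalM.
  apply: mulr_ge0.
    rewrite /with_one; case: unliftP => [j _|_]; first exact: gx.
    by rewrite mpoly.meval1.
  have [qs ->] := soss i; rewrite raddf_sum; apply: sumr_ge0 => q _.
  by rewrite /= !expr2 mpoly.mevalM -expr2 sqr_ge0.
apply: (@le_lt_trans _ _ (lebesgue_rV R n (semialg gX))); last first.
  by rewrite -ge0_fin_numE ?measure_ge0//; exact: lebesgue_rV_semialg_fin_num.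
apply: ereal_inf_lbound; exists 1; last first.
  under eq_integral do rewrite peval1.
  by rewrite integral_cst ?mul1e//; exact: measurable_semialg.
have sos0 : sos 0 by exists [::]; rewrite big_nil.
have sos1 : sos 1 by exists [:: 1]; rewrite big_seq1 expr1n.
have deg0 k : deg_le k 0 by rewrite /deg_le mpoly.msize0.
have deg1 k : deg_le k 1 by rewrite /deg_le mpoly.msize1.
split; first exact: deg1.
  rewrite subrr; exists (fun=> 0); split=> // [i|]; first by rewrite mulr0.
  by rewrite big1// => i _; rewrite mulr0.
exists (fun i => if i == ord0 then 1 else 0); split => [i|i|].
- by case: ifP.
- have [->|] := eqVneq i ord0; last by rewrite mulr0.
  by rewrite /with_one unlift_none mulr1.
rewrite big_ord_recl eqxx /with_one unlift_none mulr1 big1 ?addr0// => i _.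
by rewrite mulr0.
Qed.

End polynomials.

(* Main.v *)
Require Import Defs.
From mathcomp Require Import all_boot all_order all_algebra.
From mathcomp Require Import all_classical all_reals all_analysis.
From mathcomp Require Import complex measurable_realfun.
From mathcomp Require Import(canonicals,coercions) mpoly.
From mathcomp Require Import ring lra zify.

Set Implicit Arguments.
Unset Strict Implicit.
Unset Printing Implicit Defensive.

Import Order.TTheory GRing.Theory Num.Theory.
Import numFieldNormedType.Exports.

Local Open Scope classical_set_scope.
Local Open Scope ring_scope.

(* Feasible polynomials are built with explicit certificates, so that no
   effective Positivstellensatz is involved. With w = 1 + t, N odd and n = 2N,
   put chi(t) = 1 + (1 - (w/2)^n)^(2^n) * (w^N - 1) = 1 + t A(t), where A is a
   sum of squares. Then chi^2 is a square, chi^2 - 1 = t * 2A + (tA)^2, and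
   Bernoulli's inequality shows that chi^2 is close to 1 on [d, 1], close to 0
   on [-1, -d] and at most 4 in between, as soon as N d is large. Rescale the
   g_i describing K by c > 0 so that |c g_i| <= 1 on X. The product f of the
   chi^2(c g_i), over the i for which g_i does not vanish identically, is a sum
   of squares, f - 1 telescopes into an element of the quadratic module of K,
   and f is uniformly close to 1_K on X away from the sets {|g_i| <= t^k}. For
   suitable k the volume of these sets is O(t): this is proved by induction on
   the dimension, using that a univariate polynomial is bounded below by its
   leading coefficient times the product of the distances to the real parts of
   its roots. The degree of f is 2^(O(N)) with N of order t^(-k-1), which fits
   below d for t = 1 / ln (ln d). *)

(* chi of the header in the variable u = w / 2, with N = 2M + 1; this form makes
   sense over any ring, without division by 2. *)
Definition step_poly (A : nzRingType) (M : nat) (u : A) : A :=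
  1 + (1 - u ^+ (M.*2.+1).*2) ^+ (2 ^ (M.*2.+1).*2) *
      ((u *+ 2) ^+ M.*2.+1 - 1).

(** Applied to evaluation at a point, which reduces bounds on the polynomial [step_poly M u] to
    bounds on a real number. *)
Lemma rmorph_step_poly (A B : nzRingType) (f : {rmorphism A -> B}) M u :
  f (step_poly M u) = step_poly M (f u).
Proof.
by rewrite /step_poly rmorphD rmorph1 rmorphM rmorphXn !rmorphB rmorph1
  !rmorphXn rmorphMn.
Qed.

(** * Bernoulli inequalities *)

Section bernoulli.
Variable R : realFieldType.
Implicit Types (a : R) (k : nat).

Lemma bernoulli_ge a k : 0 <= a -> 1 + a *+ k <= (1 + a) ^+ k.
Proof.
move=> a0; elim: k => [|k IH]; first by rewrite mulr0n addr0.
rewrite exprS; apply: (@le_trans _ _ ((1 + a) * (1 + a *+ k))); last first.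
  by rewrite ler_pM2l// ltr_pwDl.
rewrite mulrS.
have : 0 <= a * (a *+ k) by rewrite mulr_ge0// mulrn_wge0.
set x := a *+ k; nra.
Qed.

Lemma bernoulli_le a k : 0 <= a <= 1 -> 1 - a *+ k <= (1 - a) ^+ k.
Proof.
move=> /andP[a0 a1]; elim: k => [|k IH]; first by rewrite mulr0n subr0.
rewrite exprS; apply: (@le_trans _ _ ((1 - a) * (1 - a *+ k))); last first.
  by rewrite ler_wpM2l// subr_ge0.
rewrite mulrS.
have : 0 <= a * (a *+ k) by rewrite mulr_ge0// mulrn_wge0.
set x := a *+ k; nra.
Qed.

(** Since [(1 - a) ^+ k * (1 + a) ^+ k = (1 - a ^+ 2) ^+ k <= 1], the lower bound on [(1 + a) ^+ k]
    inverts. *)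
Lemma bernoulli_inv a k : 0 <= a <= 1 -> (1 - a) ^+ k <= (1 + a *+ k)^-1.
Proof.
move=> /andP[a0 a1]; have k0 : 0 < 1 + a *+ k by rewrite ltr_pwDl// mulrn_wge0.
rewrite -[leRHS]mul1r ler_pdivlMr//.
apply: (@le_trans _ _ ((1 - a) ^+ k * (1 + a) ^+ k)).
  by rewrite ler_wpM2l ?bernoulli_ge// exprn_ge0// subr_ge0.
rewrite -exprMn exprn_ile1//; nra.
Qed.

End bernoulli.

(** * Pointwise bounds on the approximate step function *)

Section step_bounds.
Variable R : realFieldType.
Implicit Types (t d : R) (M : nat).

Let cut M t : R := (1 - ((1 + t) / 2) ^+ (M.*2.+1).*2) ^+ (2 ^ (M.*2.+1).*2).

Let stepE M t : step_poly M ((1 + t) / 2) = 1 + cut M t * ((1 + t) ^+ M.*2.+1 - 1).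
Proof.
rewrite /step_poly /cut; congr (1 + _ * (_ ^+ _ - 1)).
by rewrite -[(_ / 2) *+ 2]mulr_natr divfK ?pnatr_eq0.
Qed.

(** Halving keeps the base in [0, 1], as Bernoulli requires; the outer exponent [2 ^ n] of [cut]
    then exactly undoes the factor [2 ^- n]. *)
Let pow_half M t : ((1 + t) / 2) ^+ (M.*2.+1).*2 *+ (2 ^ (M.*2.+1).*2) = (1 + t) ^+ (M.*2.+1).*2.
Proof.
by rewrite -[_ *+ (2 ^ _)]mulr_natr natrX -exprMn divfK ?pnatr_eq0.
Qed.

Let half01 M t : -1 <= t <= 1 -> 0 <= ((1 + t) / 2) ^+ M <= 1.
Proof.
move=> /andP[? ?]; rewrite exprn_ge0 ?exprn_ile1//; lra.
Qed.

Let cut01 M t : -1 <= t <= 1 -> 0 <= cut M t <= 1.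
Proof.
move=> t1; have /andP[h0 h1] := half01 (M.*2.+1).*2 t1.
by rewrite /cut exprn_ge0 ?exprn_ile1// ?subr_ge0// gerBl.
Qed.

Let cut_pos M t : 0 <= t <= 1 -> cut M t <= ((1 + t) ^+ (M.*2.+1).*2)^-1.
Proof.
move=> /andP[t0 t1]; apply: (le_trans (bernoulli_inv _ (half01 _ _))); first lra.
rewrite pow_half lef_pV2 ?posrE ?lerDr// ?exprn_gt0//; last lra.
by rewrite ltr_pwDl// exprn_ge0//; lra.
Qed.

Let cut_neg M t : -1 <= t <= 0 -> 1 - (1 + t) ^+ (M.*2.+1).*2 <= cut M t.
Proof.
move=> t0; rewrite -pow_half; apply: bernoulli_le; apply: half01; lra.
Qed.

Lemma step_ge0 M t : -1 <= t <= 1 -> 0 <= step_poly M ((1 + t) / 2).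
Proof.
move=> t1; rewrite stepE; have /andP[c0 c1] := cut01 M t1.
have : 0 <= (1 + t) ^+ M.*2.+1 by rewrite exprn_ge0//; lra.
set w := (1 + t) ^+ _; set c := cut M t in c0 c1 *; nra.
Qed.

(** With w = 1 + t >= 1, [cut_pos] gives cut * w^N <= w^N / w^(2N) = w^(-N), and w^N >= (1 + d)^M >=
    1 + d M. *)
Lemma step_le_pos M t d : 0 <= d <= t -> t <= 1 ->
  step_poly M ((1 + t) / 2) <= 1 + (1 + d *+ M)^-1.
Proof.
move=> /andP[d0 dt] t1; rewrite stepE lerD2l.
have w0 : 0 < (1 + t) ^+ M.*2.+1 by rewrite exprn_gt0//; lra.
have c0 : 0 <= cut M t by have /andP[] := @cut01 M t ltac:(lra).
apply: (@le_trans _ _ (cut M t * (1 + t) ^+ M.*2.+1)).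
  by rewrite ler_wpM2l// gerBl.
apply: (@le_trans _ _ (((1 + t) ^+ M.*2.+1)^-1)).
  rewrite -ler_pdivlMr// -invfM -expr2 -exprM muln2 cut_pos//; lra.
rewrite lef_pV2 ?posrE// ?ltr_pwDl ?mulrn_wge0//.
apply: (le_trans (bernoulli_ge _ d0)).
apply: (@le_trans _ _ ((1 + t) ^+ M)).
  by apply: lerXn2r; rewrite ?nnegrE//; lra.
by apply: ler_weXn2l; [lra|rewrite -addnn -addnS leq_addr].
Qed.

(** By [cut_neg], 1 - cut + cut * w^N <= w^(2N) + w^N; both powers are at most (1 - d)^M, hence at
    most 1 / (1 + d M). *)
Lemma step_le_neg M t d : 0 <= d <= - t -> -1 <= t ->
  step_poly M ((1 + t) / 2) <= (1 + d *+ M)^-1 *+ 2.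
Proof.
move=> /andP[d0 dt] t1.
have hw k : (M <= k)%N -> (1 + t) ^+ k <= (1 + d *+ M)^-1.
  move=> Mk; apply: (@le_trans _ _ ((1 + t) ^+ M)).
    by apply: ler_wiXn2l => //; lra.
  apply: le_trans (bernoulli_inv M (_ : 0 <= d <= 1)); last lra.
  by apply: lerXn2r; rewrite ?nnegrE//; lra.
have w0 k : 0 <= (1 + t) ^+ k by rewrite exprn_ge0//; lra.
have w1 k : (1 + t) ^+ k <= 1 by rewrite exprn_ile1//; lra.
rewrite stepE; have := @cut_neg M t ltac:(lra).
have Mk : (M <= M.*2.+1)%N by rewrite -addnn -addnS leq_addr.
have := hw _ Mk; have := hw (M.*2.+1).*2.
rewrite -[X in (_ <= X)%N]addnn (leq_trans Mk (leq_addr _ _)) => /(_ isT).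
have := w0 M.*2.+1; have := w1 M.*2.+1; have := w0 (M.*2.+1).*2.
set a := (1 + t) ^+ M.*2.+1; set b := (1 + t) ^+ _.*2.
set c := cut M t; set e := (_)^-1; rewrite mulr2n; nra.
Qed.

Lemma step_sqr_le4 M t : -1 <= t <= 1 -> step_poly M ((1 + t) / 2) ^+ 2 <= 4.
Proof.
move=> t1; have h0 := step_ge0 M t1.
suff h2 : step_poly M ((1 + t) / 2) <= 2 by nra.
(* The case d = 0 of the two previous bounds gives 2 on each side of the origin. *)
have [t0|t0] := leP 0 t.
  by have := @step_le_pos M t 0; rewrite mul0rn addr0 invr1 => /(_ ltac:(lra)); lra.
by have := @step_le_neg M t 0; rewrite mul0rn addr0 invr1 => /(_ ltac:(lra)); lra.
Qed.

Lemma step_sqr_pos M t d : 0 <= d <= t -> t <= 1 ->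
  step_poly M ((1 + t) / 2) ^+ 2 <= 1 + 4 * (1 + d *+ M)^-1.
Proof.
move=> dt t1; have h0 := @step_ge0 M t ltac:(lra).
have := step_le_pos M dt t1.
have : (1 + d *+ M)^-1 <= 1.
  by rewrite invf_le1 ?ltr_pwDl ?lerDl ?mulrn_wge0//; lra.
have : 0 <= (1 + d *+ M)^-1 by rewrite invr_ge0 addr_ge0 ?mulrn_wge0//; lra.
set e := (1 + _)^-1; nra.
Qed.

Lemma step_sqr_neg M t d : 0 <= d <= - t -> -1 <= t ->
  step_poly M ((1 + t) / 2) ^+ 2 <= 4 * (1 + d *+ M)^-1.
Proof.
move=> dt t1; have h0 := @step_ge0 M t ltac:(lra).
have := step_le_neg M dt t1.
have : (1 + d *+ M)^-1 <= 1.
  by rewrite invf_le1 ?ltr_pwDl ?lerDl ?mulrn_wge0//; lra.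
have : 0 <= (1 + d *+ M)^-1 by rewrite invr_ge0 addr_ge0 ?mulrn_wge0//; lra.
rewrite mulr2n; set e := (1 + _)^-1; nra.
Qed.

End step_bounds.

(** * Degree calculus *)

Section degree.
Variables (R : realType) (n : nat).
Local Notation mp := (mpoly.mpoly n R).
Implicit Types (p q : mp) (a b : nat).

Lemma deg_leW a b p : (a <= b)%N -> deg_le a p -> deg_le b p.
Proof. by rewrite /deg_le => ab pa; rewrite (leq_trans pa). Qed.

Lemma deg_le1 a : deg_le a (1 : mp).
Proof. by rewrite /deg_le mpoly.msize1. Qed.

Lemma deg_le0 a : deg_le a (0 : mp).
Proof. by rewrite /deg_le mpoly.msize0. Qed.

Lemma deg_leD a p q : deg_le a p -> deg_le a q -> deg_le a (p + q).
Proof.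
by rewrite /deg_le => pa qa; rewrite (leq_trans (mpoly.msizeD_le _ _))// geq_max pa.
Qed.

Lemma deg_leZ a (c : R) p : deg_le a p -> deg_le a (c *: p).
Proof. by rewrite /deg_le; apply: leq_trans; exact: mpoly.msizeZ_le. Qed.

Lemma deg_leN a p : deg_le a p -> deg_le a (- p).
Proof. by rewrite -scaleN1r; exact: deg_leZ. Qed.

Lemma deg_leM a b p q : deg_le a p -> deg_le b q -> deg_le (a + b) (p * q).
Proof.
rewrite /deg_le => pa qb.
have [->|p0] := eqVneq p 0; first by rewrite mul0r mpoly.msize0.
have [->|q0] := eqVneq q 0; first by rewrite mulr0 mpoly.msize0.
rewrite mpoly.msizeM// -subn1 leq_subLR add1n -addnS -addSn.
by rewrite leq_add.
Qed.

Lemma deg_leX a k p : deg_le a p -> deg_le (a * k) (p ^+ k).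
Proof.
move=> pa; elim: k => [|k IH]; first by rewrite expr0; exact: deg_le1.
by rewrite exprS mulnS; exact: deg_leM.
Qed.

Lemma deg_le_sum a I (r : seq I) (F : I -> mp) :
  (forall i, deg_le a (F i)) -> deg_le a (\sum_(i <- r) F i).
Proof.
by move=> Fa; apply: (big_ind (deg_le a)) => // [|p q]; [exact: deg_le0|exact: deg_leD].
Qed.

Lemma exists_deg_le (m : nat) (g : 'I_m -> mp) : exists D, forall i, deg_le D (g i).
Proof.
exists (\sum_(i < m) mpoly.msize (g i))%N => i.
by rewrite /deg_le (leq_trans _ (leqnSn _))// (bigD1 i)//= leq_addr.
Qed.

End degree.

(** * Sums of squares *)

Section sos.
Variables (R : realType) (n : nat).
Local Notation mp := (mpoly.mpoly n R).
Implicit Types (p q s : mp).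

Lemma sos_sqr p : sos (p ^+ 2).
Proof. by exists [:: p]; rewrite big_seq1. Qed.

Lemma sos0 : sos (0 : mp).
Proof. by exists [::]; rewrite big_nil. Qed.

Lemma sos1 : sos (1 : mp).
Proof. by rewrite -(expr1n _ 2); exact: sos_sqr. Qed.

Lemma sosD p q : sos p -> sos q -> sos (p + q).
Proof. by move=> [s ->] [t ->]; exists (s ++ t); rewrite big_cat. Qed.

Lemma sosM p q : sos p -> sos q -> sos (p * q).
Proof.
move=> [s ->] [t ->]; exists [seq x * y | x <- s, y <- t].
rewrite big_allpairs_dep mulr_suml; apply: eq_bigr => x _.
by rewrite mulr_sumr; apply: eq_bigr => y _; rewrite exprMn.
Qed.

Lemma sosZ (c : R) p : 0 <= c -> sos p -> sos (c *: p).
Proof.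
move=> c0 [s ->]; exists [seq Num.sqrt c *: x | x <- s].
rewrite big_map scaler_sumr; apply: eq_bigr => x _.
by rewrite exprZn sqr_sqrtr.
Qed.

Lemma sos_prod I (r : seq I) (F : I -> mp) :
  (forall i, sos (F i)) -> sos (\prod_(i <- r) F i).
Proof. by move=> sF; apply: big_ind => //; [exact: sos1|exact: sosM]. Qed.

Lemma sos_peval_ge0 s x : sos s -> 0 <= peval s x.
Proof.
move=> [r ->]; rewrite /peval raddf_sum; apply: sumr_ge0 => q _.
by rewrite /= !expr2 mpoly.mevalM -expr2 sqr_ge0.
Qed.

(** Pairing neighbours gives 2 (1 + p + ... + p^(2M)) = 1 + p^(2M) + sum of (p^i + p^(i+1))^2. The
    number of terms must be odd, which is why N = 2M + 1. *)
Lemma sos_geometric p M : sos (\sum_(j < M.*2.+1) p ^+ j).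
Proof.
have -> : \sum_(j < M.*2.+1) p ^+ j =
  (2^-1 : R) *: (1 + (p ^+ M) ^+ 2 + \sum_(i < M) (p ^+ i + p ^+ i.+1) ^+ 2).
  apply: (canRL (scalerKV _)); rewrite ?invr_eq0 ?pnatr_eq0//.
  rewrite ?invrK scaler_nat; elim: M => [|M IH].
    by rewrite !big_ord_recl !big_ord0 !expr0 !addr0 mulr2n expr1n.
  rewrite doubleS !(big_ord_recr M) !(big_ord_recr M.*2.+2) (big_ord_recr M.*2.+1)/=.
  rewrite !mulrnDl IH !exprS -addnn exprD; ring.
apply: sosZ; first by rewrite invr_ge0.
apply: sosD; first by apply: sosD; [exact: sos1|exact: sos_sqr].
by apply: big_ind => [||i _]; [exact: sos0|exact: sosD|exact: sos_sqr].
Qed.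

End sos.

(** * Certificates in truncated quadratic modules *)

Section quad_module.
Variables (R : realType) (n m : nat) (g : 'I_m -> mpoly.mpoly n R).
Local Notation mp := (mpoly.mpoly n R).
Implicit Types (p q s : mp) (d e : nat).

(** Levels are kept of the form 2e throughout, so that the rounding in the degree bound of
    [quad_module] disappears. *)
Lemma double_half_even e : (2 * (2 * e)./2 = 2 * e)%N.
Proof. by rewrite [in X in (2 * X)%N]mul2n doubleK. Qed.

Lemma quad_moduleW e d p : (2 * e <= d)%N -> quad_module g (2 * e) p -> quad_module g d p.
Proof.
move=> ed [s [soss degs ->]]; exists s; split=> // i.
apply: deg_leW (degs i); rewrite double_half_even leq_mul2l/=.
by rewrite -(doubleK e) -mul2n half_leq.
Qed.

Lemma quad_moduleD d p q : quad_module g d p -> quad_module g d q -> quad_module g d (p + q).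
Proof.
move=> [s [soss degs ->]] [t [sost degt ->]]; exists (fun i => s i + t i); split.
- by move=> i; exact: sosD.
- by move=> i; rewrite mulrDr; exact: deg_leD.
- by rewrite -big_split; apply: eq_bigr => i _; rewrite mulrDr.
Qed.

Lemma quad_moduleM a b s p : sos s -> deg_le (2 * a) s -> quad_module g (2 * b) p ->
  quad_module g (2 * (a + b)) (s * p).
Proof.
move=> soss degs [t [sost degt ->]]; exists (fun i => s * t i); split.
- by move=> i; exact: sosM.
- move=> i; rewrite double_half_even mulnDr mulrCA; apply: deg_leM => //.
  by have := degt i; rewrite double_half_even.
- by rewrite mulr_sumr; apply: eq_bigr => i _; rewrite mulrCA.
Qed.

Lemma quad_module_term e (i : 'I_m.+1) s : sos s -> deg_le (2 * e) (with_one g i * s) ->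
  quad_module g (2 * e) (with_one g i * s).
Proof.
move=> soss degs; exists (fun j => if j == i then s else 0); split.
- by move=> j; case: ifP => // _; exact: sos0.
- move=> j; rewrite double_half_even; have [->//|_] := eqVneq j i.
  by rewrite mulr0; exact: deg_le0.
- rewrite (bigD1 i)//= eqxx big1 ?addr0// => j /negbTE ->; exact: mulr0.
Qed.

Lemma quad_module_sos e s : sos s -> deg_le (2 * e) s -> quad_module g (2 * e) s.
Proof.
move=> soss degs; have := @quad_module_term e ord0 s soss.
by rewrite /with_one unlift_none mul1r; exact.
Qed.

Lemma quad_module_gen e (i : 'I_m) s : sos s -> deg_le (2 * e) (g i * s) ->
  quad_module g (2 * e) (g i * s).
Proof.
move=> soss degs; have := @quad_module_term e (lift ord0 i) s soss.
by rewrite /with_one liftK; exact.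
Qed.

Lemma quad_module_prod a (r : seq 'I_m) (F : 'I_m -> mp) :
  (forall i, sos (F i)) -> (forall i, deg_le (2 * a) (F i)) ->
  (forall i, quad_module g (2 * a) (F i - 1)) ->
  deg_le (2 * (a * size r)) (\prod_(i <- r) F i) /\
  quad_module g (2 * (a * size r)) (\prod_(i <- r) F i - 1).
Proof.
move=> sF dF qF; elim: r => [|i r [dr qr]] /=.
  rewrite big_nil subrr; split; first exact: deg_le1.
  by apply: quad_module_sos; [exact: sos0|exact: deg_le0].
rewrite big_cons mulnS; split; first by rewrite mulnDr; exact: deg_leM.
(* One telescoping step: the first summand is a sum of squares times a module element, the second
   lies in the module by assumption. *)
have -> : F i * \prod_(j <- r) F j - 1 =
  F i * (\prod_(j <- r) F j - 1) + (F i - 1) by rewrite mulrBr mulr1 addrA subrK.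
apply: quad_moduleD; first exact: quad_moduleM.
by apply: quad_moduleW (qF i); rewrite leq_mul2l leq_addr.
Qed.

Definition step_deg M := ((M.*2.+1).*2 * 2 ^ (M.*2.+1).*2 + M.*2.+1)%N.

Lemma step_poly_deg D M (u : mp) : deg_le D u -> deg_le (D * step_deg M) (step_poly M u).
Proof.
move=> du; rewrite /step_poly; apply: deg_leD; first exact: deg_le1.
rewrite /step_deg mulnDr mulnA; apply: deg_leM.
  apply: deg_leX; apply: deg_leD; first exact: deg_le1.
  by apply: deg_leN; exact: deg_leX.
apply: deg_leD; last by apply: deg_leN; exact: deg_le1.
by apply: deg_leX; rewrite -scaler_nat; exact: deg_leZ.
Qed.

Lemma step_sqr_sub1 D M (i : 'I_m) (c : R) : 0 <= c -> deg_le D (g i) ->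
  quad_module g (2 * (D * step_deg M)) (step_poly M (2^-1 *: (1 + c *: g i)) ^+ 2 - 1).
Proof.
move=> c0 dg; set h := c *: g i; set u := 2^-1 *: (1 + h).
have dh : deg_le D h by exact: deg_leZ.
have du : deg_le D u by apply: deg_leZ; apply: deg_leD => //; exact: deg_le1.
have hE : u *+ 2 - 1 = h.
  by rewrite -scaler_nat scalerA divff ?pnatr_eq0// scale1r addrC addKr.
(* The cofactor A is [S * H]: [S] is a square because its exponent is even, and [H] is the geometric
   quotient of w^N - 1 by w - 1 = h. *)
set S := (1 - u ^+ (M.*2.+1).*2) ^+ (2 ^ (M.*2.+1).*2).
have sS : sos S.
  by rewrite /S [in (2 ^ _)%N]doubleS expnSr exprM; exact: sos_sqr.
have dS : deg_le (D * ((M.*2.+1).*2 * 2 ^ (M.*2.+1).*2)) S.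
  rewrite mulnA; apply: deg_leX; apply: deg_leD; first exact: deg_le1.
  by apply: deg_leN; exact: deg_leX.
set H := \sum_(j < M.*2.+1) (u *+ 2) ^+ j.
have sH : sos H by exact: sos_geometric.
have dH : deg_le (D * M.*2) H.
  apply: deg_le_sum => j; apply: (@deg_leW _ _ (D * j)).
    by rewrite leq_mul2l -ltnS ltn_ord orbT.
  by apply: deg_leX; rewrite -scaler_nat; exact: deg_leZ.
have stepE : step_poly M u = 1 + h * (S * H).
  by rewrite /step_poly subrX1 hE -/S -/H mulrCA.
(* [H] has degree only N - 1 in u, which leaves room for the extra factor h. *)
have dall : deg_le (D * step_deg M) (h * (S * H)).
  rewrite /step_deg addnS mulnS mulnDr.
  by apply: deg_leM => //; apply: deg_leM.
have -> : step_poly M u ^+ 2 - 1 = g i * (c *: (S * H *+ 2)) + (h * (S * H)) ^+ 2.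
  rewrite stepE -scalerAr scalerAl -/h; ring.
apply: quad_moduleD.
  apply: quad_module_gen.
    by rewrite -scaler_nat; do 2 apply: sosZ => //; exact: sosM.
  rewrite -scalerAr scalerAl -/h -scaler_nat -scalerAr; apply: deg_leZ.
  by apply: deg_leW dall; rewrite leq_pmull.
apply: quad_module_sos; first exact: sos_sqr.
by rewrite mulnC; exact: deg_leX.
Qed.

End quad_module.

(* The r are the real parts of the complex roots of p. *)
Lemma poly_ge_prod_dist (R : rcfType) (p : {poly R}) : p != 0 ->
  exists r : seq R, (size r).+1 = size p /\
    forall a, `|lead_coef p| * \prod_(y <- r) `|a - y| <= `|p.[a]|.
Proof.
move=> p0; have [r pE] := closed_field_poly_normal (map_poly (real_complex R) p).
exists [seq complex.Re z | z <- r]; split.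
  rewrite size_map -(size_map_poly (real_complex R)) pE size_scale.
    by rewrite size_prod_XsubC.
  by rewrite lead_coef_eq0 map_poly_eq0.
move=> a; rewrite -(@lecR R) big_map.
have -> : (`|p.[a]|)%:C%C = `|(map_poly (real_complex R) p).[a%:C%C]|.
  by rewrite horner_map normc_def /= expr0n addr0 sqrtr_sqr.
rewrite pE lead_coef_map hornerZ horner_prod normrM normr_prod rmorphM rmorph_prod /=.
rewrite normc_def /= expr0n addr0 sqrtr_sqr ler_wpM2l ?ler0c//.
apply: ler_prod => z _; rewrite ler0c normr_ge0/= hornerXsubC.
by apply: le_trans (normc_ge_Re _); case: z.
Qed.

(** * Sublevel sets of univariate polynomials *)

Section one_dim_sublevel.
Variable R : realType.
Local Notation mu := (@lebesgue_measure R).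

Definition near_seq (t : R) (r : seq R) : set (measurableTypeR R) :=
  \big[setU/set0]_(y <- r) `[y - t, y + t]%classic.

Lemma measurable_near_seq t r : measurable (near_seq t r).
Proof. by apply: bigsetU_measurable => y _; exact: measurable_itv. Qed.

Lemma lebesgue_near_seq t r : 0 <= t -> (mu (near_seq t r) <= (2 * t * (size r)%:R)%:E)%E.
Proof.
move=> t0; elim: r => [|y r IH]; first by rewrite /near_seq big_nil measure0 mulr0.
have mI : measurable (`[y - t, y + t]%classic : set (measurableTypeR R)).
  exact: measurable_itv.
rewrite /near_seq big_cons; apply: (le_trans (measureU2 mu mI (measurable_near_seq t r))).
rewrite /= -(natr1 (size r)) mulrDr mulr1 addrC EFinD leeD//.
rewrite lebesgue_measure_itv /= lte_fin; case: ifP => // _.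
  by rewrite lee_fin; lra.
by rewrite lee_fin; lra.
Qed.

(** At distance more than t from every point of r, the lower bound by distances gives at least
    |lead_coef p| t^deg, which exceeds s t^deg. *)
Lemma poly_sublevel (p : {poly R}) (s t : R) : 0 < s < `|lead_coef p| -> 0 < t ->
  exists2 r, (size r).+1 = size p &
    [set a : measurableTypeR R | `|p.[a]| <= s * t ^+ (size p).-1] `<=` near_seq t r.
Proof.
move=> /andP[s0 sp] t0.
have p0 : p != 0 by rewrite -lead_coef_eq0 -normr_gt0 (lt_trans s0).
have [r [rs rp]] := poly_ge_prod_dist p0; exists r => // a /= ha.
suff [y yr ya] : exists2 y, y \in r & `|a - y| <= t.
  rewrite /near_seq -bigcup_seq; exists y => //=.
  by rewrite in_itv/=; move: ya; rewrite ler_norml; lra.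
apply/not_exists2P => far.
have : \prod_(y <- r) t <= \prod_(y <- r) `|a - y|.
  rewrite !big_seq; apply: ler_prod => y yr; rewrite ltW//=.
  by rewrite leNgt; apply/negP => /ltW; have [|] := far y.
rewrite big_const_seq count_predT iter_mulr_1 => tr.
have := le_trans (rp a) ha; rewrite -rs /=; apply/negP; rewrite -ltNge.
apply: (@lt_le_trans _ _ (`|lead_coef p| * t ^+ size r)).
  by rewrite ltr_pM2r// exprn_gt0.
by rewrite ler_wpM2l.
Qed.

End one_dim_sublevel.

Lemma product_measure_le_ysection d1 d2 (T1 : measurableType d1) (T2 : measurableType d2)
    (R : realType) (m1 : {sigma_finite_measure set T1 -> \bar R})
    (m2 : {sigma_finite_measure set T2 -> \bar R}) (S : set (T1 * T2)) (D : set T2) (c : R) :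
  measurable S -> measurable D -> 0 <= c ->
  (forall x y, S (x, y) -> D y) ->
  (forall y, D y -> (m1 (ysection S y) <= c%:E)%E) ->
  ((m1 \x m2) S <= c%:E * m2 D)%E.
Proof.
move=> mS mD c0 SD Sc.
(* Uniqueness of the product measure allows integrating the [m1]-measure of the y-sections over the
   second factor; these sections are empty outside D. *)
rewrite (@product_measure_unique _ _ _ _ _ m1 m2 (m1 \x^ m2)%E)//; last first.
  by move=> A B mA mB; exact: product_measure2E.
rewrite -integral_cst// [leRHS]integral_mkcond; apply: ge0_le_integral => //.
- exact: measurable_fun_ysection.
- exact/(measurable_restrictT _ mD).
- move=> y _; rewrite patchE; case: ifPn => yD; first exact: Sc (set_mem yD).
  rewrite (_ : (m1 \o ysection S) y = 0%E)//=.
  rewrite (_ : ysection S y = set0) ?measure0//.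
  apply/seteqP; split=> // x; rewrite /ysection /= => /set_mem /SD Dy.
  by move: yD; rewrite mem_set.
Qed.

(** * Volume of sublevel sets in the cube *)

Section sublevel.
Variable R : realType.
Local Notation mp n := (mpoly.mpoly n R).

Lemma rV_unconsK n : cancel (@rV_uncons R n) (@rV_cons R n).
Proof.
move=> x; apply/rowP => i; have [j ->|->] := unliftP ord0 i.
  by rewrite rV_consS mxE; congr (x _ _); exact: val_inj.
by rewrite rV_cons0.
Qed.

(** Monomials are grouped by their exponent [e] in the first variable; [tl] is the exponent vector
    of the remaining variables. *)
Lemma peval_rV_cons n (p : mp n.+1) : exists k (q : nat -> mp n),
  forall a x, peval p (rV_cons (a, x)) = \sum_(j < k) peval (q j) x * a ^+ j.
Proof.
pose e (m : mpoly.multinom n.+1) : nat := m ord0.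
pose tl (m : mpoly.multinom n.+1) : mpoly.multinom n :=
  mpoly.Multinom [tuple m (lift ord0 i) | i < n].
pose q j : mp n := \sum_(m <- mpoly.msupp p | e m == j)
  mpoly.mcoeff m p *: mpoly.mpolyX R (tl m).
exists (\max_(m <- mpoly.msupp p) e m).+1, q => a x.
rewrite /peval mpoly.mevalE.
transitivity (\sum_(j < (\max_(m <- mpoly.msupp p) e m).+1)
    \sum_(m <- mpoly.msupp p | e m == j)
      mpoly.mcoeff m p * \prod_i (rV_cons (a, x)) ord0 i ^+ m i).
  rewrite (exchange_big_dep xpredT)//= big_seq [RHS]big_seq; apply: eq_bigr => m ms.
  have em : (e m < (\max_(m <- mpoly.msupp p) e m).+1)%N.
    by rewrite ltnS; exact: leq_bigmax_seq.
  by rewrite (big_pred1 (Ordinal em)).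
apply: eq_bigr => j _; rewrite raddf_sum mulr_suml.
apply: eq_bigr => m /eqP <- /=; rewrite mpoly.mevalZ mpoly.mevalX -mulrA; congr (_ * _).
rewrite big_ord_recl rV_cons0 mulrC; congr (_ * _).
apply: eq_bigr => i _; rewrite rV_consS; congr (_ ^+ _).
by rewrite mpoly.multinomE tnth_mktuple.
Qed.

(** The cube stands in for the ball because its slices are again cubes, as the induction on the
    dimension needs. *)
Definition cube n : set 'rV[R]_n := [set x | forall i, `[-1, 1]%classic (x ord0 i)].

Lemma measurable_cube n : measurable (@cube n).
Proof. by apply: (@measurable_rV_box R n (fun=> `[-1, 1]%classic)) => i; exact: measurable_itv. Qed.

Lemma lebesgue_cube n : lebesgue_rV R n (@cube n) = (2 ^+ n)%:E.
Proof.
rewrite (@lebesgue_rV_box R n (fun=> `[-1, 1]%classic)); last first.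
  by move=> i; exact: measurable_itv.
transitivity (\prod_(i < n) (2 : R)%:E)%E.
  apply: eq_bigr => i _; rewrite lebesgue_measure_itv /= lte_fin ifT; last by lra.
  by rewrite -EFinD; congr EFin; lra.
by rewrite prodEFin big_const_ord iter_mulr_1.
Qed.

Definition cube_sublevel n (p : mp n) (s : R) : set 'rV[R]_n :=
  @cube n `&` [set x | `|peval p x| <= s].

Lemma measurable_cube_sublevel n (p : mp n) s : measurable (cube_sublevel p s).
Proof.
apply: measurableI; first exact: measurable_cube.
rewrite (_ : [set x | _] = (Num.norm \o peval p) @^-1` `]-oo, s]); last first.
  by apply/seteqP; split=> x /=; rewrite in_itv.
rewrite -[_ @^-1` _]setTI; apply: measurableT_comp => //.
exact: measurable_peval.
Qed.

(** Where the top coefficient in the first variable is at most t^l, the induction hypothesis bounds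
    the volume. Elsewhere each fibre of the set |p| <= t^(l+k) lies in k intervals of length 2t. *)
Lemma lebesgue_cube_sublevel n (p : mp n) : (forall x, peval p x = 0) \/
  exists (c : R) k, 0 <= c /\ forall t, 0 < t <= 1 ->
    (lebesgue_rV R n (cube_sublevel p (t ^+ k)) <= (c * t)%:E)%E.
Proof.
elim: n p => [|n IHn] p.
  have [p0|p0] := eqVneq (peval p 0) 0.
    by left=> x; rewrite [x]thinmx0 p0.
  (* In dimension 0 the measure is a unit mass, and |p 0| <= t forces 1 <= t / |p 0|. *)
  right; exists (`|peval p 0|^-1), 1%N; split; first by rewrite invr_ge0.
  move=> t /andP[t0 t1] /=; rewrite diracE lee_fin.
  case: (boolP (0 \in _)) => [/set_mem[_ /=]|_]; last first.
    by rewrite mulr_ge0 ?invr_ge0// ltW.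
  by rewrite expr1 ler_pdivlMl ?mulr1// normr_gt0.
have [k [q pE]] := peval_rV_cons p.
(* Identically vanishing top coefficients are peeled off until a genuine one is found. *)
elim: k pE => [|k IHk] pE.
  by left=> x; rewrite -(rV_unconsK x) pE big_ord0.
have [q0|[c [l [c0 qc]]]] := IHn (q k).
  by apply: IHk => a x; rewrite pE big_ord_recr /= q0 mul0r addr0.
(* First term: [-1, 1] times the bad set of the top coefficient. Second term: k intervals of length
   2t over a cube of volume 2^n. *)
right; exists (2 * c + 2 * k%:R * 2 ^+ n), (l + k)%N; split.
  by rewrite addr_ge0 ?mulr_ge0.
move=> t t01; have /andP[t0 t1] := t01.
set S := cube_sublevel p _; set A := cube_sublevel (q k) (t ^+ l).
have mS : measurable S by exact: measurable_cube_sublevel.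
have mA : measurable A by exact: measurable_cube_sublevel.
have mT : measurable (@rV_cons R n @^-1` S).
  by rewrite -[_ @^-1` _]setTI; apply: measurable_rV_cons.
pose I11 : set (measurableTypeR R) := `[-1, 1]%classic.
have mI : measurable I11 by exact: measurable_itv.
have cubeS a x : @cube n.+1 (rV_cons (a, x)) -> I11 a /\ @cube n x.
  move=> h; split; first by have := h ord0; rewrite rV_cons0.
  by move=> i; have := h (lift ord0 i); rewrite rV_consS.
pose T2 := (@rV_cons R n @^-1` S) `&` (setT `*` (@cube n `\` A)).
have mD : measurable (@cube n `\` A) by apply: measurableD => //; exact: measurable_cube.
have mT2 : measurable T2 by apply: measurableI => //; exact: measurableX.
rewrite /= /lebesgue_rV_step /pushforward.
apply: (@le_trans _ _ ((@lebesgue_measure R \x lebesgue_rV R n) ((I11 `*` A) `|` T2))%E).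
  apply: le_measure; rewrite ?inE//.
    by apply: measurableU => //; exact: measurableX.
  move=> [a x] Sax; have [ha hx] := cubeS a x Sax.1.
  by have [Ax|Ax] := pselect (A x); [left|right].
apply: (le_trans (measureU2 _ _ mT2)); first exact: measurableX.
rewrite mulrDl EFinD; apply: leeD.
  rewrite [leLHS](_ : _ = lebesgue_measure I11 * lebesgue_rV R n A)%E; last first.
    exact: product_measure1E.
  rewrite -mulrA EFinM; apply: lee_pmul => //; last exact: qc.
  by rewrite lebesgue_measure_itv /= lte_fin ifT -?EFinD ?lee_fin; lra.
apply: (@le_trans _ _ ((2 * t * k%:R)%:E * lebesgue_rV R n (@cube n))%E); last first.
  by rewrite lebesgue_cube -EFinM lee_fin le_eqVlt; apply/orP; left; apply/eqP; ring.
apply: (@le_trans _ _ ((2 * t * k%:R)%:E * lebesgue_rV R n (@cube n `\` A))%E); last first.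
  apply: lee_wpmul2l; first by rewrite lee_fin !mulr_ge0// ltW.
  by apply: le_measure; rewrite ?inE//; exact: measurable_cube.
apply: product_measure_le_ysection => //; first by rewrite !mulr_ge0// ltW.
  by move=> a x [_ []].
move=> x [cx Ax].
have qx : t ^+ l < `|peval (q k) x|.
  by rewrite ltNge; apply/negP => qx; apply: Ax.
pose P : {poly R} := \poly_(j < k.+1) peval (q j) x.
have Pk : peval (q k) x != 0.
  by rewrite -normr_gt0 (lt_trans _ qx)// exprn_gt0.
have sP : size P = k.+1 by rewrite size_poly_eq.
have lP : lead_coef P = peval (q k) x by rewrite lead_coef_poly.
have [|r rP Pr] := @poly_sublevel R P (t ^+ l) t _ t0.
  by rewrite lP qx exprn_gt0.
have -> : k = size r by apply/succn_inj; rewrite rP sP.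
apply: le_trans (lebesgue_near_seq r (ltW t0)).
apply: le_measure; rewrite ?inE.
- exact: measurable_ysection.
- exact: measurable_near_seq.
- move=> a /ysectionP [Sax _]; apply: Pr => /=.
  have := Sax.2; rewrite /= pE sP exprD /P horner_poly; exact.
Qed.

End sublevel.

(** * Degree growth against ln ln d *)

Lemma step_deg_le M : (step_deg M <= 2 ^ (8 * M + 4))%N.
Proof.
rewrite /step_deg; set N := M.*2.+1.
(* The chain is 2N 4^N + N <= 3N 4^N <= 4^N 4^N = 2^(4N), with 4N = 8M + 4. *)
have N4 : (3 * N <= 4 ^ N)%N.
  rewrite /N; elim: M.*2 => [//|k IH]; rewrite expnS; lia.
have -> : (2 ^ (8 * M + 4) = 4 ^ N * 4 ^ N)%N.
  by rewrite -expnD -[4%N in RHS]/(2 ^ 2)%N -expnM /N; congr (2 ^ _)%N; lia.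
have -> : (2 ^ N.*2 = 4 ^ N)%N by rewrite -mul2n expnM.
have : (0 < 4 ^ N)%N by rewrite expn_gt0.
move: N4; set Q := (4 ^ N)%N; nia.
Qed.

Section growth.
Variable R : realType.

Lemma near_ln_ln_ge (A : R) : \forall d \near \oo, 1 < d%:R :> R /\ A <= ln (ln (d%:R : R)).
Proof.
near=> d.
have dA : expR (expR A) <= d%:R :> R by near: d; exact: nbhs_infty_ger.
have d0 : (0 : R) < d%:R by apply: lt_le_trans dA; exact: expR_gt0.
have lA : expR A <= ln (d%:R : R).
  by rewrite -[leLHS]expRK ler_ln// posrE expR_gt0.
split.
  by apply: lt_le_trans dA; rewrite expR_gt1 expR_gt0.
rewrite -[leLHS]expRK ler_ln// posrE ?expR_gt0//.
by apply: lt_le_trans lA; exact: expR_gt0.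
Unshelve. all: by end_near. Qed.

(** With l = ln ln d and M of order l^k, the degree is at most e^(B + 8M + 4), while d = e^(e^l). It
    remains to compare a polynomial in l with e^l >= 1 + l^(k+2) / (k+2)!. *)
Lemma degree_budget (k B : nat) : \forall d \near \oo,
  1 <= ln (ln (d%:R : R)) /\
  exists M, ln (ln (d%:R : R)) ^+ k <= M%:R /\ (B * step_deg M <= d)%N.
Proof.
near=> d.
have [d1 lA] : 1 < d%:R :> R /\ ((B + 20) * (k.+2)`!)%:R <= ln (ln (d%:R : R)).
  by near: d; exact: near_ln_ln_ge.
set l := ln _ in lA *.
have fact1 : (1 <= ((B + 20) * (k.+2)`!))%N by rewrite muln_gt0 fact_gt0 addnS.
have l1 : 1 <= l by apply: le_trans lA; rewrite ler1n.
split=> //.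
have ld : 0 < ln (d%:R : R) by rewrite ln_gt0.
have lk1 : 1 <= l ^+ k by rewrite exprn_ege1.
exists (Num.truncn (l ^+ k)).+1; split.
  by rewrite ltW// truncnS_gt.
set M := (Num.truncn _).+1.
have M_le : M%:R <= l ^+ k + 1.
  by rewrite /M -natr1 lerD2r truncn_le// (le_trans ler01).
apply: (@leq_trans (2 ^ (B + (8 * M + 4)))).
  by rewrite expnD leq_mul ?step_deg_le// ltnW// ltn_expl.
rewrite -(ler_nat R) natrX.
have two_le : 2 <= expR 1 :> R by have := expR_ge1Dx (1 : R); lra.
apply: (@le_trans _ _ (expR 1 ^+ (B + (8 * M + 4)))).
  by rewrite lerXn2r ?nnegrE ?expR_ge0.
rewrite -expRM_natl -[leRHS]lnK ?posrE ?(lt_trans ltr01)// ler_expR mulr1.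
rewrite -[leRHS]lnK ?posrE// -/l.
apply: le_trans (expR_ge1Dxn k.+1 (le_trans ler01 l1)).
(* From M <= l^k + 1 and l^k >= 1; the 20 is 8 + 8 + 4. *)
apply: (@le_trans _ _ ((B + 20)%:R * l ^+ k)).
  by rewrite !natrD natrM; have : 0 <= B%:R :> R by []; nra.
apply: (@le_trans _ _ (l ^+ k.+2 / (k.+2)`!%:R)); last by rewrite lerDr.
rewrite ler_pdivlMr ?ltr0n ?fact_gt0// mulrAC -natrM exprS ler_pM//.
  by rewrite exprn_ge0// (le_trans ler01).
by rewrite exprS ler_peMl// exprn_ge0// (le_trans ler01).
Unshelve. all: by end_near. Qed.

End growth.

(** * Products of factors bounded by 4 *)

Section majorant_product.
Variable R : realFieldType.

Lemma prod_le_pow4 (I : Type) (r : seq I) (F : I -> R) :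
  (forall i, 0 <= F i <= 4) -> 0 <= \prod_(i <- r) F i <= 4 ^+ size r.
Proof.
move=> F4; elim: r => [|i r /andP[IH0 IH]]; first by rewrite big_nil ler01 lexx.
have /andP[F0 Fi4] := F4 i.
by rewrite big_cons exprS mulr_ge0//= ler_pM.
Qed.

(** Inductively F (1 + 5^s e) <= 1 + e + 4 * 5^s e, and e <= 5^s e; hence the base 5 = 4 + 1. *)
Lemma prod_le_near1 (I : Type) (r : seq I) (F : I -> R) (e : R) : 0 <= e ->
  (forall i, 0 <= F i <= 4) -> (forall i, F i <= 1 + e) ->
  \prod_(i <- r) F i <= 1 + 5 ^+ size r * e.
Proof.
move=> e0 F4 Fe; elim: r => [|i r IH].
  by rewrite big_nil expr0 mul1r lerDl.
have /andP[F0 Fi4] := F4 i.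
rewrite big_cons /= exprS; apply: (le_trans (ler_wpM2l F0 IH)).
have : 1 <= 5 ^+ size r :> R by rewrite exprn_ege1// ler1n.
have := Fe i; set a := 5 ^+ size r => Fie a1.
have ae : e <= a * e by rewrite ler_peMl.
have : F i * (a * e) <= 4 * (a * e) by rewrite ler_wpM2r// mulr_ge0// (le_trans ler01).
rewrite mulrDr mulr1 -[5 * a * e]mulrA; lra.
Qed.

Lemma prod_le_small (I : eqType) (r : seq I) (F : I -> R) (e : R) j : 0 <= e ->
  (forall i, 0 <= F i <= 4) -> j \in r -> F j <= e ->
  \prod_(i <- r) F i <= 4 ^+ size r * e.
Proof.
move=> e0 F4 jr Fj; rewrite (big_rem j)//= mulrC.
have /andP[Fj0 _] := F4 j.
have /andP[P0 P4] := prod_le_pow4 (rem j r) F4.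
apply: ler_pM => //; apply: (le_trans P4); rewrite size_rem//.
by rewrite ler_weXn2l ?ler1n ?leq_pred.
Qed.

End majorant_product.

(** * Normalization of the constraints on the cube *)

Section coefficient_bound.
Variables (R : realType) (n : nat).
Local Notation mp := (mpoly.mpoly n R).

Lemma unit_ball_cube : @unit_ball R n `<=` @cube R n.
Proof.
move=> x /= x1 i; rewrite /= in_itv/= -ler_norml -sqrtr_sqr.
apply: le_trans x1; apply: ler_wsqrtr; rewrite (bigD1 i)//= lerDl.
by apply: sumr_ge0 => j _; exact: sqr_ge0.
Qed.

Lemma peval_cube_le (p : mp) x : cube x ->
  `|peval p x| <= \sum_(m <- mpoly.msupp p) `|mpoly.mcoeff m p|.
Proof.
move=> xc; rewrite /peval mpoly.mevalE; apply: (le_trans (ler_norm_sum _ _ _)).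
apply: ler_sum => m _; rewrite normrM ler_piMr// normr_prod.
apply: prodr_ile1 => i _; rewrite normr_ge0 normrX exprn_ile1//=.
by have := xc i; rewrite /= in_itv/= ler_norml.
Qed.

Lemma normalizing_constant m (g : 'I_m -> mp) : exists2 c : R, 0 < c <= 1 &
  forall i x, cube x -> -1 <= c * peval (g i) x <= 1.
Proof.
pose b i := \sum_(mm <- mpoly.msupp (g i)) `|mpoly.mcoeff mm (g i)|.
have b0 i : 0 <= b i by exact: sumr_ge0.
have s0 : 0 <= \sum_i b i by exact: sumr_ge0.
(* Monomials are at most 1 in absolute value on the cube, so [b i] bounds |g_i|; the added 1 avoids
   division by zero and gives c <= 1. *)
exists (1 + \sum_i b i)^-1.
  by rewrite invr_gt0 ltr_pwDl//= invf_le1 ?lerDl// ltr_pwDl.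
move=> i x xc; rewrite -ler_norml normrM ger0_norm; last first.
  by rewrite invr_ge0 addr_ge0.
rewrite mulrC ler_pdivrMr ?ltr_pwDl// mul1r (le_trans (peval_cube_le _ xc))//.
rewrite -/(b i) (bigD1 i)//=; have : 0 <= \sum_(j < m | j != i) b j by exact: sumr_ge0.
by lra.
Qed.

End coefficient_bound.

(** * The exceptional set near the zeros of the constraints *)

Section uniform_sublevel.
Variables (R : realType) (n m : nat) (g : 'I_m -> mpoly.mpoly n R).

(** An identically vanishing g_i imposes no constraint, but its sublevel sets fill the cube, so it
    is left out. *)
Definition nonzero_idx : seq 'I_m :=
  [seq i <- enum 'I_m | ~~ `[< forall x, peval (g i) x = 0 >]].

Lemma nonzero_idxPn i : i \notin nonzero_idx -> forall x, peval (g i) x = 0.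
Proof.
by rewrite mem_filter mem_enum andbT negbK => /asboolP.
Qed.

Definition small_set (s : R) : set 'rV[R]_n :=
  \big[setU/set0]_(i <- nonzero_idx) cube_sublevel (g i) s.

Lemma measurable_small_set s : measurable (small_set s).
Proof. by apply: bigsetU_measurable => i _; exact: measurable_cube_sublevel. Qed.

Lemma small_setPn s x i : i \in nonzero_idx -> cube x -> ~ small_set s x ->
  s < `|peval (g i) x|.
Proof.
move=> ir xc xs; rewrite ltNge; apply/negP => gs; apply: xs.
by rewrite /small_set -bigcup_seq; exists i.
Qed.

Lemma lebesgue_small_set : exists c k, 0 <= c /\ forall t, 0 < t <= 1 ->
  (lebesgue_rV R n (small_set (t ^+ k)) <= (c * t)%:E)%E.
Proof.
(* The induction runs over sublists; this invariant records that their entries do not vanish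
   identically. *)
rewrite /small_set; have : all (mem nonzero_idx) nonzero_idx by apply/allP.
elim: {2 3}nonzero_idx => [_|i r IH /= /andP[ir rr]].
  exists 0, 0%N; split=> // t _; by rewrite big_nil measure0 mul0r.
have [c [k [c0 ck]]] := IH rr.
have [gi0|[c' [k' [c'0 c'k']]]] := lebesgue_cube_sublevel (g i).
  by move: ir; rewrite mem_filter => /andP[/asboolP ni _].
(* For t <= 1 a larger exponent shrinks the sublevel sets, so the maximum serves all indices. *)
exists (c' + c), (maxn k' k); split; first exact: addr_ge0.
move=> t t01; rewrite big_cons mulrDl EFinD.
have mono l : (l <= maxn k' k)%N -> t ^+ maxn k' k <= t ^+ l.
  by move=> ll; move/andP: t01 => [t0 t1]; rewrite ler_wiXn2l// ltW.
have submono l j : (l <= maxn k' k)%N ->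
    cube_sublevel (g j) (t ^+ maxn k' k) `<=` cube_sublevel (g j) (t ^+ l).
  by move=> /mono ll x [xc /= gx]; split=> //=; exact: le_trans ll.
apply: (le_trans (measureU2 _ _ _)).
- exact: measurable_cube_sublevel.
- by apply: bigsetU_measurable => j _; exact: measurable_cube_sublevel.
apply: leeD.
- apply: le_trans (c'k' t t01); apply: le_measure; rewrite ?inE.
  + exact: measurable_cube_sublevel.
  + exact: measurable_cube_sublevel.
  + by apply: submono; exact: leq_maxl.
- apply: le_trans (ck t t01); apply: le_measure; rewrite ?inE.
  + by apply: bigsetU_measurable => j _; exact: measurable_cube_sublevel.
  + by apply: bigsetU_measurable => j _; exact: measurable_cube_sublevel.
  + rewrite -!bigcup_seq; apply: subset_bigcup => j _.
    by apply: submono; exact: leq_maxr.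
Qed.

End uniform_sublevel.

(** * The lower bound by vol K *)

Section feasible.
Variables (R : realType) (n : nat).
Local Notation mp := (mpoly.mpoly n R).

Lemma quad_module_ge0 m (g : 'I_m -> mp) d p x :
  quad_module g d p -> semialg g x -> 0 <= peval p x.
Proof.
move=> [s [soss _ ->]] gx; rewrite /peval raddf_sum; apply: sumr_ge0 => i _.
rewrite /= mpoly.mevalM mulr_ge0//; last exact: sos_peval_ge0.
rewrite /with_one; case: unliftP => [j _|_]; first exact: gx.
by rewrite mpoly.meval1.
Qed.

(** A feasible p is at least 1 on K and nonnegative on X, so its integral over X is at least vol
    K. *)
Lemma vstar_ge_volume mK (gK : 'I_mK -> mp) mX (gX : 'I_mX -> mp) d :
  semialg gK `<=` semialg gX ->
  (lebesgue_rV R n (semialg gK) <= vstar gK gX d)%E.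
Proof.
move=> KX; have mK' := measurable_semialg gK; have mX' := measurable_semialg gX.
apply: le_ereal_inf_tmp => _ [p [_ pK pX] <-].
have mp A : measurable A -> measurable_fun A (fun x => (peval p x)%:E).
  move=> mA; apply/measurable_EFinP; apply: measurable_funTS.
  exact: measurable_peval.
apply: (@le_trans _ _ (\int[lebesgue_rV R n]_(x in semialg gK) (peval p x)%:E)%E).
  rewrite -[leLHS]mul1e -integral_cst//; apply: ge0_le_integral => //.
  - exact: mp.
  - move=> x Kx; rewrite lee_fin -subr_ge0.
    have := quad_module_ge0 pK Kx.
    by rewrite /peval mpoly.mevalB mpoly.meval1.
apply: ge0_subset_integral => //; first exact: mp.
by move=> x Xx; rewrite lee_fin; exact: quad_module_ge0 pX Xx.
Qed.

End feasible.

(** * The feasible polynomial and its bounds *)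

Section candidate.
Variables (R : realType) (n m : nat) (g : 'I_m -> mpoly.mpoly n R).
Variables (c : R) (M : nat).
Hypothesis c01 : 0 < c <= 1.
Hypothesis gc : forall i x, cube x -> -1 <= c * peval (g i) x <= 1.

Definition candidate : mpoly.mpoly n R :=
  \prod_(i <- nonzero_idx g) step_poly M (2^-1 *: (1 + c *: g i)) ^+ 2.

Let factor i x := step_poly M ((1 + c * peval (g i) x) / 2) ^+ 2.

Let peval_candidate x : peval candidate x = \prod_(i <- nonzero_idx g) factor i x.
Proof.
rewrite /peval /candidate rmorph_prod; apply: eq_bigr => i _ /=.
rewrite (rmorphXn (mpoly.meval (fun i => x ord0 i)))/=.
rewrite (rmorph_step_poly (mpoly.meval (fun i => x ord0 i)))/=; congr (step_poly _ _ ^+ 2).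
by rewrite mpoly.mevalZ mpoly.mevalD mpoly.meval1 mpoly.mevalZ mulrC.
Qed.

Let factor04 i x : cube x -> 0 <= factor i x <= 4.
Proof. by move=> xc; rewrite sqr_ge0 step_sqr_le4// gc. Qed.

Lemma candidate_le_off_small_set t k x : 0 < t <= 1 -> t^-1 <= t ^+ k * M%:R -> cube x ->
  ~ small_set g (t ^+ k) x ->
  peval candidate x <= \1_(semialg g) x + 5 ^+ size (nonzero_idx g) * (4 / c * t).
Proof.
move=> /andP[t0 t1] tM xc xs; rewrite peval_candidate; have /andP[c0 c1] := c01.
set e := 4 / c * t.
have e0 : 0 <= e by rewrite mulr_ge0 ?divr_ge0// ltW.
have d0 : 0 <= c * t ^+ k by rewrite mulr_ge0 ?exprn_ge0// ltW.
(* Because t^k M >= 1/t, the left side is at most 4 / (c t^k M) <= 4t / c. *)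
have eE : 4 * (1 + (c * t ^+ k) *+ M)^-1 <= e.
  rewrite /e -mulrA ler_pM2l// -[leRHS]invrK lef_pV2 ?posrE; last 2 first.
  - by rewrite ltr_pwDl// mulrn_wge0.
  - by rewrite invr_gt0 mulr_gt0// invr_gt0.
  rewrite invfM invrK -mulr_natr -mulrA.
  by apply: (@le_trans _ _ (c * (t ^+ k * M%:R))); [rewrite ler_pM2l|rewrite lerDr].
have dlt i : i \in nonzero_idx g -> c * t ^+ k < c * `|peval (g i) x|.
  by move=> ir; rewrite ltr_pM2l// small_setPn.
have F4 i : 0 <= factor i x <= 4 by exact: factor04.
rewrite indicE; have [Kx|Kx] := pselect (semialg g x).
  rewrite mem_set//=.
  (* [prod_le_near1] asks for bounds at every index, so the factors outside the list are replaced by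
     0. *)
  pose F i := if i \in nonzero_idx g then factor i x else 0.
  rewrite big_seq (eq_bigr F) -?big_seq; last by move=> i ir; rewrite /F ir.
  apply: prod_le_near1 => // i; rewrite /F; case: ifPn => // ir.
  - by rewrite lexx ler0n.
  - have gi0 : 0 <= peval (g i) x by exact: Kx.
    apply: (le_trans (step_sqr_pos (d := c * t ^+ k) _ _ _)).
    + by rewrite d0/= ltW//; have := dlt i ir; rewrite ger0_norm.
    + by have /andP[] := gc i xc.
    + by rewrite lerD2l.
  - by rewrite addr_ge0.
rewrite memNset// add0r.
(* Outside K some constraint is violated, and a violated one does not vanish identically; its factor
   alone makes the product small. *)
have [j jr gj] : exists2 j, j \in nonzero_idx g & peval (g j) x < 0.
  apply: contrapT => noj; apply: Kx => j /=.
  have [jr|jr] := boolP (j \in nonzero_idx g); last by rewrite nonzero_idxPn.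
  by rewrite leNgt; apply/negP => gj; apply: noj; exists j.
apply: (@le_trans _ _ (4 ^+ size (nonzero_idx g) * e)); last first.
  by rewrite ler_wpM2r// lerXn2r ?nnegrE// ler_nat.
apply: (prod_le_small (j := j)) => //.
apply: (le_trans _ eE); apply: step_sqr_neg.
  by rewrite d0/= ltW//; have := dlt j jr; rewrite ltr0_norm// mulrN.
by have /andP[] := gc j xc.
Qed.

(** A crude bound, for use on the exceptional set; 4 is relaxed to 5 so that one constant serves
    both estimates. *)
Lemma candidate_ge0_le x : cube x ->
  0 <= peval candidate x <= 5 ^+ size (nonzero_idx g).
Proof.
move=> xc; rewrite peval_candidate.
have /andP[-> h]/= := prod_le_pow4 (nonzero_idx g) (fun i => factor04 i xc).
by apply: (le_trans h); rewrite lerXn2r ?nnegrE// ler_nat.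
Qed.

Lemma candidate_certificate D d : (forall i, deg_le D (g i)) ->
  (2 * (D * step_deg M * size (nonzero_idx g)) <= d)%N ->
  [/\ sos candidate, deg_le (2 * (D * step_deg M * size (nonzero_idx g))) candidate,
      deg_le d candidate & quad_module g d (candidate - 1)].
Proof.
move=> dg dle; have c0 : 0 <= c by case/andP: c01 => /ltW.
have [|||dc qc] := @quad_module_prod R n m g (D * step_deg M) (nonzero_idx g)
  (fun i => step_poly M (2^-1 *: (1 + c *: g i)) ^+ 2).
- by move=> i; exact: sos_sqr.
- move=> i; rewrite mulnC; apply: deg_leX; apply: step_poly_deg.
  by apply: deg_leZ; apply: deg_leD; [exact: deg_le1|exact: deg_leZ].
- by move=> i; exact: step_sqr_sub1.
split.
- by apply: sos_prod => i; exact: sos_sqr.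
- exact: dc.
- exact: deg_leW dc.
- exact: quad_moduleW qc.
Qed.

End candidate.

(** * The convergence rate *)

Theorem corollary1 (R : realType) (n nK nX : nat)
    (gK : 'I_nK -> mpoly.mpoly n R) (gX : 'I_nX -> mpoly.mpoly n R) :
  let K := semialg gK in
  let X := semialg gX in
  compact K -> compact X ->
  K `<=` X -> X `<=` @unit_ball R n ->
  (exists i, gK i = ball_poly R n) ->
  (exists i, gX i = ball_poly R n) ->
  interior K 0 ->
  finite_gibbs K X ->
  (fun d : nat => fine (vstar gK gX d - lebesgue_rV R n K)%E)
    =O_\oo (fun d : nat => (ln (ln (d%:R : R)))^-1).
Proof.
move=> K X _ _ KX XB _ _ _ _.
have [c c01 gc] := normalizing_constant gK.
have [D dg] := exists_deg_le gK.
have [C [k [C0 smallC]]] := lebesgue_small_set gK.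
set r := nonzero_idx gK in smallC.
have /andP[c0 c1] := c01.
have mK : measurable K by exact: measurable_semialg.
have mX : measurable X by exact: measurable_semialg.
have Xcube : X `<=` @cube R n by apply: subset_trans XB _; exact: unit_ball_cube.
have volK : lebesgue_rV R n K \is a fin_num.
  by apply: lebesgue_rV_semialg_fin_num; apply: subset_trans KX XB.
pose A : R := 5 ^+ size r.
have A0 : 0 <= A by rewrite exprn_ge0.
(* [A * C] comes from the exceptional set, [A * (4 / c) * 2 ^+ n] from the uniform error over the
   cube; the 1 makes the constant positive. *)
apply/eqO_exP; exists (A * (C + 4 / c * 2 ^+ n) + 1).
  by rewrite ltr_pwDr// mulr_ge0// addr_ge0// mulr_ge0 ?exprn_ge0// divr_ge0// ltW.
near=> d.
(* The exponent is k + 1 because with t = 1/l the condition 1/t <= t^k M reads l^(k+1) <= M. *)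
have [l1 [M [lM Md]]] : 1 <= ln (ln (d%:R : R)) /\ exists M,
    ln (ln (d%:R : R)) ^+ k.+1 <= M%:R /\ (2 * D * size r * step_deg M <= d)%N.
  near: d; exact: degree_budget.
set l := ln _ in l1 lM *; set t := l^-1.
have l0 : 0 < l by rewrite (lt_le_trans ltr01).
have t01 : 0 < t <= 1 by rewrite invr_gt0 l0 invf_le1.
have /andP[t0 t1] := t01.
have tM : t^-1 <= t ^+ k * M%:R.
  by rewrite /t exprVn invrK mulrC ler_pdivlMr ?exprn_gt0// -exprS.
have Md' : (2 * (D * step_deg M * size r) <= d)%N.
  by apply: leq_trans Md; rewrite [X in (_ <= X)%N]mulnAC !mulnA.
have [sosf degf2 degf qf] := candidate_certificate c01 dg Md'.
set f := candidate gK c M in sosf degf2 degf qf.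
have lo := vstar_ge_volume d KX.
have hi : (vstar gK gX d <= lebesgue_rV R n K + (A * (C + 4 / c * 2 ^+ n) * t)%:E)%E.
  apply: (@le_trans _ _ (\int[lebesgue_rV R n]_(x in X) (peval f x)%:E)%E).
    apply: ereal_inf_lbound; exists f => //; split => //.
    exact: quad_moduleW Md' (quad_module_sos gX sosf degf2).
  set E := small_set gK (t ^+ k).
  have mE : measurable E by exact: measurable_small_set.
  (* On E the crude bound A applies, off E the error term; integrating over X gives the upper
     estimate. *)
  have bound x : X x -> peval f x <= \1_K x + A * \1_E x + A * (4 / c * t).
    move=> /Xcube xc; rewrite [\1_E x]indicE.
    have [Ex|Ex] := pselect (E x).
      rewrite mem_set// mulr1; have /andP[_ fA] := candidate_ge0_le M gc xc.
      apply: (le_trans fA); rewrite -/A addrAC lerDr addr_ge0//.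
      by rewrite !mulr_ge0 ?invr_ge0// ltW.
    rewrite memNset// mulr0 addr0.
    exact: (candidate_le_off_small_set c01 gc t01 tM xc Ex).
  apply: (@le_trans _ _ (\int[lebesgue_rV R n]_(x in X)
     ((\1_K x)%:E + A%:E * (\1_E x)%:E + (A * (4 / c * t))%:E))%E).
    apply: ge0_le_integral => //.
    - by move=> x /Xcube xc; rewrite lee_fin; case/andP: (candidate_ge0_le M gc xc).
    - by apply/measurable_EFinP; apply: measurable_funTS; exact: measurable_peval.
    - have mpt : measurable_fun X (fun x => \1_K x + A * \1_E x + A * (4 / c * t)).
        apply: measurable_funD => //; apply: measurable_funD; first exact: measurable_indic.
        by apply: measurable_funM => //; exact: measurable_indic.
      by apply/measurable_EFinP.
  have m1 (B : set 'rV[R]_n) : measurable B -> measurable_fun X (fun x => (\1_B x)%:E : \bar R).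
    by move=> mB; apply/measurable_EFinP; exact: measurable_indic.
  have ind0 (B : set 'rV[R]_n) x : (0 <= (\1_B x)%:E :> \bar R)%E by rewrite lee_fin indicE.
  have e0 : 0 <= A * (4 / c * t) by rewrite !mulr_ge0 ?invr_ge0// ltW.
  have Aind0 x : (0 <= A%:E * (\1_E x)%:E)%E by rewrite mule_ge0.
  rewrite ge0_integralD//; last 2 first.
  - by move=> x _; rewrite adde_ge0.
  - by apply: emeasurable_funD; [exact: m1|apply: measurable_funeM; exact: m1].
  rewrite ge0_integralD//; [|exact: m1|by apply: measurable_funeM; exact: m1].
  rewrite ge0_integralZl//; last exact: m1.
  rewrite !integral_indic// integral_cst//.
  have KXE : K `&` X = K by apply/setIidPl.
  rewrite KXE -addeA leeD2l//.
  have -> : A * (C + 4 / c * 2 ^+ n) * t = A * (C * t) + A * (4 / c * t) * 2 ^+ n by ring.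
  rewrite EFinD; apply: leeD.
    rewrite EFinM; apply: lee_wpmul2l => //; apply: le_trans (smallC t t01).
    by apply: le_measure; rewrite ?inE//; exact: measurableI.
  rewrite [leRHS]EFinM; apply: lee_wpmul2l => //; rewrite -lebesgue_cube.
  by apply: le_measure; rewrite ?inE//; exact: measurable_cube.
have vfin : vstar gK gX d \is a fin_num := vstar_fin_num gK d XB.
rewrite -/K in lo; move: lo hi.
rewrite -(fineK vfin) -(fineK volK) -EFinD !lee_fin -EFinB /= => lo hi.
rewrite ger0_norm ?subr_ge0// ger0_norm ?(ltW t0)// mulrDl mul1r.
rewrite lerBlDl; apply: (le_trans hi).
by rewrite lerD2l lerDl ltW.
Unshelve. all: by end_near. Qed.
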